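(* The affine gauge transformation $s\mapsto t+\alpha$ transforms the Kowalevski top with $c=-1$ to the Jurdjevic elasticae according to the formulae $$\tau=-\alpha,\quad I_2=3l_1,\quad I_3=2l,\quad I_4=1-\alpha^2-6l_1\alpha.$$ (That is, with $c=-1$, $I_1=k^2$ and these identifications of constants, $E_\alpha=\hat E$, $F_\alpha=\hat F$, $G_\alpha=\hat G$ as polynomials in $x_1,x_2$, in the notation of the context.)
   Context: Kowalevski top data, with constants $c,l_1,l,k$: $$E=6l_1-(x_1+x_2)^2,\quad F=2cl+x_1x_2(x_1+x_2),\quad G=c^2-k^2-x_1^2x_2^2,$$ which occur in its first integrals $$r^2=E+e_1+e_2,\quad rc\gamma_3=F-x_2e_1-x_1e_2,\quad c^2\gamma_3^2=G+x_2^2e_1+x_1^2e_2,\quad e_1e_2=k^2.$$ The associated discriminantly separable polynomial is $\mathcal F(x_1,x_2,s)=As^2+Bs+C$ with $$A=(x_1-x_2)^2,\quad B=-2\big(Ex_1x_2+F(x_1+x_2)+G\big),\quad C=F^2-EG.$$ The substitution $s\mapsto t+\alpha$ turns $\mathcal F$ into $\mathcal F_\alpha=A_\alpha t^2+B_\alpha t+C_\alpha$ with $A_\alpha=A$, $B_\alpha=B+2\alpha A$, $C_\alpha=C+\alpha B+\alpha^2A$, and $C_\alpha=F_\alpha^2-E_\alpha G_\alpha$ where $$E_\alpha=6l_1-(x_1+x_2)^2+2\alpha,\quad F_\alpha=2cl+x_1x_2(x_1+x_2)-\alpha(x_1+x_2),\quad G_\alpha=c^2-k^2-x_1^2x_2^2+2\alpha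 x_1x_2.$$ Jurdjevic elasticae: the Hamiltonian system with $H=\frac14(M_1^2+M_2^2+2M_3^2)+\gamma_1$ and deformed Poisson structure $\{M_i,M_j\}_\tau=\epsilon_{ijk}M_k$, $\{M_i,\gamma_j\}_\tau=\epsilon_{ijk}\gamma_k$, $\{\gamma_i,\gamma_j\}_\tau=\tau\epsilon_{ijk}M_k$. Put $x_{1,2}=\frac{M_1\pm iM_2}{2}$, $e_1=x_1^2-(\gamma_1+i\gamma_2)+\tau$, $e_2=x_2^2-(\gamma_1-i\gamma_2)+\tau$. Its integrals of motion are $I_1=e_1e_2$, $I_2=H$, $I_3=\gamma_1M_1+\gamma_2M_2+\gamma_3M_3$, $I_4=\gamma_1^2+\gamma_2^2+\gamma_3^2+\tau(M_1^2+M_2^2+M_3^2)$, which may be rewritten as $$k^2=I_1=e_1e_2,\quad M_3^2=e_1+e_2+\hat E,\quad -M_3\gamma_3=-x_2e_1-x_1e_2+\hat F,\quad \gamma_3^2=x_2^2e_1+x_1^2e_2+\hat G,$$ with $$\hat E=-(x_1+x_2)^2+2(I_2-\tau),\quad \hat F=(x_1x_2+\tau)(x_1+x_2)-I_3,\quad \hat G=-x_1^2x_2^2-2\tau x_1x_2-2\tau I_2+\tau^2+I_4-I_1.$$ ''Transforms to'' means that the data $(E_\alpha,F_\alpha,G_\alpha)$ of the gauge-transformed polynomial coincide with the data $(\hat E,\hat F,\hat G)$ of the elasticae. *)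

(* Defs.v *)
(* The field of complex numbers is R[i], for R : realType. *)
From HB Require Import structures.
From mathcomp Require Import all_boot all_order all_algebra.
From mathcomp Require Import reals complex mpoly ring.

Set Implicit Arguments.
Unset Strict Implicit.
Unset Printing Implicit Defensive.

Import GRing.Theory.
Local Open Scope ring_scope.

(* The data of both systems are written over an arbitrary commutative ring V,
   in which the constants and the variables x1, x2 live.  They are read as
   polynomials in x1, x2 when V is {mpoly R[i][2]}, x1 = 'X_0, x2 = 'X_1 and
   the constants come from R[i]; they are read on the phase space of the
   elasticae when V is the ring of observables defined further below. *)

Section Kowalevski.
Variables (V : comNzRingType) (x1 x2 : V) (c l1 l k : V).

Definition kowE : V := 6 * l1 - (x1 + x2) ^+ 2.
Definition kowF : V := 2 * c * l + x1 * x2 * (x1 + x2).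
Definition kowG : V := c ^+ 2 - k ^+ 2 - x1 ^+ 2 * x2 ^+ 2.

Definition kowA : V := (x1 - x2) ^+ 2.
Definition kowB : V := - 2 * (kowE * x1 * x2 + kowF * (x1 + x2) + kowG).
Definition kowC : V := kowF ^+ 2 - kowE * kowG.

(* Polynomial in the third variable s. *)
Definition kow_poly : {poly V} := kowA *: 'X^2 + kowB *: 'X + kowC%:P.

Variable alpha : V.

Definition gaugeA : V := kowA.
Definition gaugeB : V := kowB + 2 * alpha * kowA.
Definition gaugeC : V := kowC + alpha * kowB + alpha ^+ 2 * kowA.

Definition gaugeE : V := 6 * l1 - (x1 + x2) ^+ 2 + 2 * alpha.
Definition gaugeF : V :=
  2 * c * l + x1 * x2 * (x1 + x2) - alpha * (x1 + x2).
Definition gaugeG : V :=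
  c ^+ 2 - k ^+ 2 - x1 ^+ 2 * x2 ^+ 2 + 2 * alpha * x1 * x2.

End Kowalevski.

(* The substitution s |-> t + alpha in a polynomial in s. *)
Definition affine_gauge (V : comNzRingType) (alpha : V) (p : {poly V}) :
  {poly V} := p \Po ('X + alpha%:P).

Section ElasticaeData.
Variables (V : comNzRingType) (x1 x2 : V) (tau I1 I2 I3 I4 : V).

Definition elE : V := - (x1 + x2) ^+ 2 + 2 * (I2 - tau).
Definition elF : V := (x1 * x2 + tau) * (x1 + x2) - I3.
Definition elG : V :=
  - (x1 ^+ 2 * x2 ^+ 2) - 2 * tau * x1 * x2 - 2 * tau * I2 + tau ^+ 2
  + I4 - I1.

End ElasticaeData.

(* Algebra behind the two theorems on the elasticae stated further below: h is
   1/2, i is the imaginary unit, br the bracket, eps i j X stands for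
   \sum_k epsilon_ijk X_k. *)
Section ElasticaeAlgebra.
Variables (V : comNzRingType) (h i t : V) (M g : 'I_3 -> V).
Hypotheses (h2 : 2 * h = 1) (ii : i * i = -1).

Notation M1 := (M 0). Notation M2 := (M 1). Notation M3 := (M 2).
Notation g1 := (g 0). Notation g2 := (g 1). Notation g3 := (g 2).

Let H := h * h * (M1 ^+ 2 + M2 ^+ 2 + 2 * M3 ^+ 2) + g1.
Let x1 := h * (M1 + i * M2).
Let x2 := h * (M1 - i * M2).
Let e1 := x1 ^+ 2 - (g1 + i * g2) + t.
Let e2 := x2 ^+ 2 - (g1 - i * g2) + t.
Let I3 := g1 * M1 + g2 * M2 + g3 * M3.
Let I4 := g1 ^+ 2 + g2 ^+ 2 + g3 ^+ 2 + t * (M1 ^+ 2 + M2 ^+ 2 + M3 ^+ 2).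

Let half2 f : h * (2 * f) = f.
Proof. by rewrite mulrCA mulrA h2 mul1r. Qed.

Let double_half f : f = 2 * (h * f).
Proof. by rewrite mulrA h2 mul1r. Qed.

Let coord_halves :
  [/\ x1 = h * M1 + i * (h * M2), x2 = h * M1 - i * (h * M2)
    & H = (h * M1) ^+ 2 + (h * M2) ^+ 2 + 2 * (h * M3) ^+ 2 + g1].
Proof. by split; rewrite /x1 /x2 /H; ring. Qed.

Lemma elasticae_relations_algebra :
  [/\ M3 ^+ 2 = e1 + e2 + elE x1 x2 t H,
      - (M3 * g3) = - x2 * e1 - x1 * e2 + elF x1 x2 t I3
    & g3 ^+ 2 = x2 ^+ 2 * e1 + x1 ^+ 2 * e2 + elG x1 x2 t (e1 * e2) H I4].
Proof.
rewrite /elE /elF /elG /I3 /I4 /e1 /e2.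
have [-> -> ->] := coord_halves.
move: (double_half M1) (double_half M2) (double_half M3).
move: (h * M1) (h * M2) (h * M3) => a b z -> -> ->.
by split; ring: ii.
Qed.

Variables (br : V -> V -> V) (eps : 'I_3 -> 'I_3 -> ('I_3 -> V) -> V).
Hypothesis brDl : forall f f' k, br (f + f') k = br f k + br f' k.
Hypothesis brDr : forall f f' k, br k (f + f') = br k f + br k f'.
Hypothesis brMl : forall f f' k, br (f * f') k = f * br f' k + f' * br f k.
Hypothesis brMr : forall f f' k, br k (f * f') = f * br k f' + f' * br k f.
Hypothesis brh : forall f, br f h = 0 /\ br h f = 0.
Hypothesis bri : forall f, br i f = 0.
Hypothesis brt : forall f, br t f = 0.
Hypothesis epsE : forall X,
  [/\ [/\ eps 0 0 X = 0, eps 0 1 X = X 2 & eps 0 2 X = - X 1],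
      [/\ eps 1 0 X = - X 2, eps 1 1 X = 0 & eps 1 2 X = X 0]
    & [/\ eps 2 0 X = X 1, eps 2 1 X = - X 0 & eps 2 2 X = 0]].
Hypothesis brE : forall j k,
  [/\ br (M j) (M k) = eps j k M, br (M j) (g k) = eps j k g,
      br (g j) (M k) = eps j k g & br (g j) (g k) = t * eps j k M].

Let br0 f : br 0 f = 0.
Proof. by apply: (addrI (br 0 f)); rewrite -brDl !addr0. Qed.

Let brN f k : br (- f) k = - br f k.
Proof. by apply/eqP; rewrite -addr_eq0 -brDl addNr br0. Qed.

Let br2 f k : br (2 * f) k = 2 * br f k.
Proof. by rewrite !mulr_natl !mulr2n brDl. Qed.

Let br2r f k : br k (2 * f) = 2 * br k f.
Proof. by rewrite !mulr_natl !mulr2n brDr. Qed.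

Let brhr f k : br k (h * f) = h * br k f.
Proof. by rewrite brMr (brh k).1 mulr0 addr0. Qed.

Let brhl f k : br (h * f) k = h * br f k.
Proof. by rewrite brMl (brh k).2 mulr0 addr0. Qed.

Let bril f k : br (i * f) k = i * br f k.
Proof. by rewrite brMl bri mulr0 addr0. Qed.

Let brtl f k : br (t * f) k = t * br f k.
Proof. by rewrite brMl brt mulr0 addr0. Qed.

Let brX f k : br (f ^+ 2) k = 2 * f * br f k.
Proof. by rewrite expr2 brMl; ring. Qed.

Let brXr f k : br k (f ^+ 2) = 2 * f * br k f.
Proof. by rewrite expr2 brMr; ring. Qed.

Let br_H f : br f H =
  2 * ((h * M1) * (h * br f M1) + (h * M2) * (h * br f M2)
       + 2 * (h * M3) * (h * br f M3)) + br f g1.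
Proof.
have [_ _ ->] := coord_halves.
by rewrite !brDr br2r !brXr !brhr; ring.
Qed.

Lemma elasticae_integrals_algebra :
  [/\ br (e1 * e2) H = 0, br H H = 0, br I3 H = 0 & br I4 H = 0].
Proof.
have [[m00 m01 m02] [m10 m11 m12] [m20 m21 m22]] := epsE M.
have [[n00 n01 n02] [n10 n11 n12] [n20 n21 n22]] := epsE g.
have brMM j k : br (M j) (M k) = eps j k M by case: (brE j k).
have brMg j k : br (M j) (g k) = eps j k g by case: (brE j k).
have brgM j k : br (g j) (M k) = eps j k g by case: (brE j k).
have brgg j k : br (g j) (g k) = t * eps j k M by case: (brE j k).
have [[D1 D2 D3] [d1 d2 d3]] :
  [/\ br M1 H = 2 * - ((h * M2) * (h * M3)),
      br M2 H = 2 * ((h * M1) * (h * M3) - h * g3)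
    & br M3 H = 2 * (h * g2)] /\
  [/\ br g1 H = 2 * ((h * M2) * (h * g3) - 2 * (h * M3) * (h * g2)),
      br g2 H =
        2 * (2 * (h * M3) * (h * g1) - (h * M1) * (h * g3) - t * (h * M3))
    & br g3 H =
        2 * ((h * M1) * (h * g2) - (h * M2) * (h * g1) + t * (h * M2))].
  rewrite !br_H !brMM !brMg !brgM !brgg.
  rewrite m00 m01 m02 m10 m11 m12 m20 m21 m22.
  rewrite n00 n01 n02 n10 n11 n12 n20 n21 n22 !mulrN !mulr0.
  move: (double_half M2) (double_half M3) (double_half g2) (double_half g3).
  move: (h * M1) (h * M2) (h * M3) (h * g1) (h * g2) (h * g3) => a b z u v w.
  by move: M2 M3 g2 g3 => m2 m3 w2 w3 -> -> -> ->; split; split; ring.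
have [x1E x2E HE] := coord_halves.
have Dx1 : br x1 H =
    - (h * M2 * (h * M3)) + i * (h * M1 * (h * M3) - h * g3).
  by rewrite x1E brDl bril !brhl D1 D2 !half2.
have Dx2 : br x2 H =
    - (h * M2 * (h * M3)) - i * (h * M1 * (h * M3) - h * g3).
  by rewrite x2E brDl brN bril !brhl D1 D2 !half2.
have De1 : br e1 H = 2 * x1 * br x1 H - (br g1 H + i * br g2 H).
  by rewrite /e1 !brDl brN brDl brX bril brt addr0.
have De2 : br e2 H = 2 * x2 * br x2 H - (br g1 H - i * br g2 H).
  by rewrite /e2 !brDl brN brDl brN brX bril brt addr0.
split.
- rewrite brMl De1 De2 Dx1 Dx2 d1 d2 /e1 /e2 x1E x2E.
  move: (double_half g1) (double_half g2).
  move: (h * M1) (h * M2) (h * M3) (h * g1) (h * g2) (h * g3) => a b z u v w.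
  by move: g1 g2 => w1 w2 -> ->; ring: ii.
- rewrite [X in br X _]HE !brDl br2 !brX !brhl D1 D2 D3 d1 !half2; ring.
- rewrite !brDl !brMl D1 D2 D3 d1 d2 d3.
  move: (double_half M1) (double_half M2) (double_half M3).
  move: (double_half g1) (double_half g2) (double_half g3).
  move: (h * M1) (h * M2) (h * M3) (h * g1) (h * g2) (h * g3) => a b z u v w.
  move: M1 M2 M3 g1 g2 g3 => m1 m2 m3 w1 w2 w3.
  by move=> -> -> -> -> -> ->; ring.
rewrite !brDl brtl !brDl !brX D1 D2 D3 d1 d2 d3.
move: (double_half M1) (double_half M2) (double_half M3).
move: (double_half g1) (double_half g2) (double_half g3).
move: (h * M1) (h * M2) (h * M3) (h * g1) (h * g2) (h * g3) => a b z u v w.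
move: M1 M2 M3 g1 g2 g3 => m1 m2 m3 w1 w2 w3.
by move=> -> -> -> -> -> ->; ring.
Qed.

End ElasticaeAlgebra.

(* The Hamiltonian system of the elasticae, on the complexified phase space:
   observables are the polynomials in M_1, M_2, M_3, gamma_1, gamma_2, gamma_3.
   elasticae_relations is what makes elE, elF, elG the data of that system, and
   elasticae_integrals checks that elI1, ..., elI4 are integrals of motion.
   Indices run over 'I_3, so they are shifted by one. *)
Section ElasticaeSystem.
Variables (R : realType) (tau : R[i]).

Definition observable := {mpoly R[i][3 + 3]}.

Definition elM (i : 'I_3) : observable := 'X_(lshift 3 i).
Definition elgamma (i : 'I_3) : observable := 'X_(rshift 3 i).

Definition levi_civita (i j k : 'I_3) : R[i] :=
  if (j == i + 1) && (k == i + 2) then 1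
  else if (j == i + 2) && (k == i + 1) then -1 else 0.

Definition poisson_tensor (u v : 'I_(3 + 3)) : observable :=
  match split u, split v with
  | inl i, inl j => \sum_k levi_civita i j k *: elM k
  | inl i, inr j => \sum_k levi_civita i j k *: elgamma k
  | inr i, inl j => \sum_k levi_civita i j k *: elgamma k
  | inr i, inr j => \sum_k (tau * levi_civita i j k) *: elM k
  end.

Definition poisson (f g : observable) : observable :=
  \sum_u \sum_v poisson_tensor u v * f^`M(u) * g^`M(v).

Notation M1 := (elM 0). Notation M2 := (elM 1). Notation M3 := (elM 2).
Notation g1 := (elgamma 0). Notation g2 := (elgamma 1).
Notation g3 := (elgamma 2).
Notation "c %:O" := (c%:MP : observable) (at level 2, left associativity).

Definition elH : observable :=
  (4^-1)%:O * (M1 ^+ 2 + M2 ^+ 2 + 2 * M3 ^+ 2) + g1.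

Definition elx1 : observable := (2^-1)%:O * (M1 + 'i%C%:O * M2).
Definition elx2 : observable := (2^-1)%:O * (M1 - 'i%C%:O * M2).
Definition ele1 : observable := elx1 ^+ 2 - (g1 + 'i%C%:O * g2) + tau%:O.
Definition ele2 : observable := elx2 ^+ 2 - (g1 - 'i%C%:O * g2) + tau%:O.

Definition elI1 : observable := ele1 * ele2.
Definition elI2 : observable := elH.
Definition elI3 : observable := g1 * M1 + g2 * M2 + g3 * M3.
Definition elI4 : observable :=
  g1 ^+ 2 + g2 ^+ 2 + g3 ^+ 2 + tau%:O * (M1 ^+ 2 + M2 ^+ 2 + M3 ^+ 2).

Lemma i2O : 'i%C%:O * 'i%C%:O = -1.
Proof. by rewrite -mpolyCM -expr2 sqr_i mpolyCN mpolyC1. Qed.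

Lemma halfO : 2 * (2^-1)%:O = 1.
Proof.
have -> : (2 : observable) = 2%:O by rewrite mpolyCMn mpolyC1.
by rewrite -mpolyCM divff ?mpolyC1 // Num.Theory.pnatr_eq0.
Qed.

Lemma quarterO : (4^-1)%:O = (2^-1)%:O * (2^-1)%:O.
Proof. by rewrite -mpolyCM -invfM -natrM. Qed.

Lemma poissonDl f g h : poisson (f + g) h = poisson f h + poisson g h.
Proof.
rewrite -big_split; apply: eq_bigr => u _; rewrite -big_split /=.
by apply: eq_bigr => v _; rewrite mderivD; ring.
Qed.

Lemma poissonDr f g h : poisson h (f + g) = poisson h f + poisson h g.
Proof.
rewrite -big_split; apply: eq_bigr => u _; rewrite -big_split /=.
by apply: eq_bigr => v _; rewrite mderivD; ring.
Qed.

Lemma poissonMl f g h : poisson (f * g) h = f * poisson g h + g * poisson f h.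
Proof.
rewrite !mulr_sumr -big_split; apply: eq_bigr => u _.
rewrite !mulr_sumr -big_split /=.
by apply: eq_bigr => v _; rewrite mderivM; ring.
Qed.

Lemma poissonMr f g h : poisson h (f * g) = f * poisson h g + g * poisson h f.
Proof.
rewrite !mulr_sumr -big_split; apply: eq_bigr => u _.
rewrite !mulr_sumr -big_split /=.
by apply: eq_bigr => v _; rewrite mderivM; ring.
Qed.

Lemma poissonCl c f : poisson c%:O f = 0.
Proof.
by rewrite /poisson; do 2!rewrite big1 // => ? _; rewrite mderivC mulr0 mul0r.
Qed.

Lemma poissonCr c f : poisson f c%:O = 0.
Proof.
by rewrite /poisson; do 2!rewrite big1 // => ? _; rewrite mderivC mulr0.
Qed.

Lemma poissonXX u v : poisson 'X_u 'X_v = poisson_tensor u v.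
Proof.
have dX (w w' : 'I_(3 + 3)) : ('X_w : observable)^`M(w') = (w == w')%:R.
  rewrite mderivX mnm1E; case: eqVneq => [->|_]; last by rewrite scale0r.
  by rewrite scale1r (_ : (U_(w') - U_(w') = 0)%MM) ?mpolyX0 //; apply/mnmP => j; rewrite mnmBE subnn mnm0E.
rewrite /poisson (bigD1 u) //= [X in _ + X]big1 ?addr0 => [|w nw].
  rewrite (bigD1 v) //= big1 ?addr0 => [|w nw]; rewrite !dX ?eqxx ?mulr1 //.
  by rewrite eq_sym (negPf nw) mulr0.
by rewrite big1 // => w' _; rewrite dX eq_sym (negPf nw) mulr0 mul0r.
Qed.

Lemma poisson_coord i j :
  [/\ poisson (elM i) (elM j) = \sum_k levi_civita i j k *: elM k,
      poisson (elM i) (elgamma j) = \sum_k levi_civita i j k *: elgamma k,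
      poisson (elgamma i) (elM j) = \sum_k levi_civita i j k *: elgamma k
    & poisson (elgamma i) (elgamma j) =
        \sum_k (tau * levi_civita i j k) *: elM k].
Proof.
have sl k : split (lshift 3 k : 'I_(3 + 3)) = inl k by exact: (unsplitK (inl k)).
have sr k : split (rshift 3 k : 'I_(3 + 3)) = inr k by exact: (unsplitK (inr k)).
by split; rewrite poissonXX /poisson_tensor ?sl ?sr.
Qed.

Lemma sum_levi_civita (X : 'I_3 -> observable) :
  let S i j := \sum_k levi_civita i j k *: X k in
  [/\ [/\ S 0 0 = 0, S 0 1 = X 2 & S 0 2 = - X 1],
      [/\ S 1 0 = - X 2, S 1 1 = 0 & S 1 2 = X 0]
    & [/\ S 2 0 = X 1, S 2 1 = - X 0 & S 2 2 = 0]].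
Proof.
have red i j : \sum_k levi_civita i j k *: X k =
    levi_civita i j 0 *: X 0 + levi_civita i j 1 *: X 1
    + levi_civita i j 2 *: X 2.
  rewrite !big_ord_recl big_ord0 addr0 addrA.
  have -> : lift ord0 (ord0 : 'I_2) = 1 :> 'I_3 by apply/val_inj.
  by have -> : lift ord0 (lift ord0 (ord0 : 'I_1)) = 2 :> 'I_3 by apply/val_inj.
move=> S; rewrite /S; split; split; rewrite red /levi_civita /=;
  by rewrite ?scale0r ?scale1r ?scaleN1r ?add0r ?addr0.
Qed.

Lemma poisson_gammagamma i j :
  poisson (elgamma i) (elgamma j) =
    tau%:O * \sum_k levi_civita i j k *: elM k.
Proof.
case: (poisson_coord i j) => _ _ _ ->; rewrite mul_mpolyC scaler_sumr.
by apply: eq_bigr => k _; rewrite scalerA.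
Qed.

Theorem elasticae_relations :
  [/\ M3 ^+ 2 = ele1 + ele2 + elE elx1 elx2 tau%:O elI2,
      - (M3 * g3) =
        - elx2 * ele1 - elx1 * ele2 + elF elx1 elx2 tau%:O elI3
    & g3 ^+ 2 =
        elx2 ^+ 2 * ele1 + elx1 ^+ 2 * ele2
        + elG elx1 elx2 tau%:O elI1 elI2 elI4].
Proof.
rewrite /elI2 /elH quarterO.
exact: (elasticae_relations_algebra _ _ _ halfO i2O).
Qed.

Theorem elasticae_integrals :
  [/\ poisson elI1 elH = 0, poisson elI2 elH = 0,
      poisson elI3 elH = 0 & poisson elI4 elH = 0].
Proof.
rewrite /elI2 /elH quarterO.
apply: (@elasticae_integrals_algebra _ _ _ tau%:O elM elgamma halfO i2O
  poisson (fun j k X => \sum_l levi_civita j k l *: X l)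
  poissonDl poissonDr poissonMl poissonMr).
- by move=> f; rewrite poissonCl poissonCr.
- exact: poissonCl.
- exact: poissonCl.
- exact: sum_levi_civita.
move=> j k; have [MM Mg gM _] := poisson_coord j k.
by split; [exact: MM|exact: Mg|exact: gM|exact: poisson_gammagamma].
Qed.

End ElasticaeSystem.

(* Main.v *)
Require Import Defs.
From mathcomp Require Import all_boot all_order all_algebra.
From mathcomp Require Import reals complex mpoly ring.

Set Implicit Arguments.
Unset Strict Implicit.
Unset Printing Implicit Defensive.

Import GRing.Theory.
Local Open Scope ring_scope.

Lemma affine_gauge_kow_poly (V : comNzRingType) (x1 x2 c l1 l k alpha : V) :
  affine_gauge alpha (kow_poly x1 x2 c l1 l k)
    = gaugeA x1 x2 *: 'X^2 + gaugeB x1 x2 c l1 l k alpha *: 'X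
      + (gaugeC x1 x2 c l1 l k alpha)%:P.
Proof.
rewrite /affine_gauge /kow_poly !comp_polyD !comp_polyZ rmorphXn /= comp_polyX.
(* Scalings become products with constant polynomials, leaving an identity for [ring] in
   [{poly V}]. *)
rewrite comp_polyC /gaugeA /gaugeB /gaugeC -!mul_polyC.
rewrite !(polyCD, polyCM, polyCN, polyC_exp, polyC1).
by ring.
Qed.

(** The shifts of $E,F,G$ are $2\alpha$, $-\alpha(x_1+x_2)$, $2\alpha x_1x_2$. In
    $F_\alpha^2-E_\alpha G_\alpha$ the linear term in $\alpha$ is $\alpha B$, and
    $(x_1+x_2)^2-4x_1x_2=A$ gives the quadratic one. *)
Lemma gaugeC_discriminant (V : comNzRingType) (x1 x2 c l1 l k alpha : V) :
  gaugeC x1 x2 c l1 l k alpha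
    = gaugeF x1 x2 c l alpha ^+ 2
      - gaugeE x1 x2 l1 alpha * gaugeG x1 x2 c k alpha.
Proof.
rewrite /gaugeC /kowC /kowB /kowA /kowE /kowF /kowG /gaugeE /gaugeF /gaugeG.
by ring.
Qed.

(* The first two conclusions say that (E_alpha, F_alpha, G_alpha) are the data
   of the polynomial obtained from the one of the Kowalevski top by
   s |-> t + alpha; the last three identify them with those of the elasticae,
   as polynomials in x1 = 'X_0 and x2 = 'X_1. *)
Theorem proposition6 (R : realType)
  (c l1 l k alpha tau I1 I2 I3 I4 : R[i])
  (hc : c = -1) (hI1 : I1 = k ^+ 2)
  (htau : tau = - alpha) (hI2 : I2 = 3 * l1) (hI3 : I3 = 2 * l)
  (hI4 : I4 = 1 - alpha ^+ 2 - 6 * l1 * alpha) :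
  let x1 : {mpoly R[i][2]} := 'X_0 in
  let x2 : {mpoly R[i][2]} := 'X_1 in
  let Ea := gaugeE x1 x2 l1%:MP alpha%:MP in
  let Fa := gaugeF x1 x2 c%:MP l%:MP alpha%:MP in
  let Ga := gaugeG x1 x2 c%:MP k%:MP alpha%:MP in
  let Aa := gaugeA x1 x2 in
  let Ba := gaugeB x1 x2 c%:MP l1%:MP l%:MP k%:MP alpha%:MP in
  let Ca := gaugeC x1 x2 c%:MP l1%:MP l%:MP k%:MP alpha%:MP in
  [/\ affine_gauge alpha%:MP (kow_poly x1 x2 c%:MP l1%:MP l%:MP k%:MP)
        = Aa *: 'X^2 + Ba *: 'X + Ca%:P,
      Ca = Fa ^+ 2 - Ea * Ga,
      Ea = elE x1 x2 tau%:MP I2%:MP,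
      Fa = elF x1 x2 tau%:MP I3%:MP
    & Ga = elG x1 x2 tau%:MP I1%:MP I2%:MP I4%:MP].
Proof.
move=> x1 x2 Ea Fa Ga Aa Ba Ca.
split; first exact: affine_gauge_kow_poly.
- exact: gaugeC_discriminant.
- rewrite /Ea /gaugeE /elE htau hI2 mpolyCN mpolyCM !(mpolyCMn, mpolyC1).
  by ring.
(* The value $c=-1$ turns $2cl$ into $-I_3$. *)
- rewrite /Fa /gaugeF /elF hc htau hI3 !mpolyCN mpolyCM !(mpolyCMn, mpolyC1).
  by ring.
(* [hI4] is what makes the constant term $-2\tau I_2+\tau^2+I_4-I_1$ collapse to $1-k^2=c^2-k^2$. *)
rewrite /Ga /gaugeG /elG hc hI1 htau hI2 hI4.
rewrite !(mpolyCD, mpolyCN, mpolyCM, mpolyCMn, mpolyC1, expr2).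
by ring.
Qed.
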